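(* Let $\overline{p}=(p_i)_{i\geq 1}$ be a sequence in $]0,1]$. The Markov chain on $\mathbb{N}$ given by the stochastic Fibonacci adding machine associated to $\overline{p}$ is transient if and only if $\prod_{i=1}^{\infty}p_i>0$.
   Context: $\mathbb{N}=\{0,1,2,\ldots\}$. Fibonacci numbers: $F_0=1$, $F_1=2$, $F_n=F_{n-1}+F_{n-2}$ for $n\geq 2$. Every $N\in\mathbb{N}$ has a unique Fibonacci expansion $N=\sum_{i\geq 0}\varepsilon_i(N)F_i$ with $\varepsilon_i(N)\in\{0,1\}$, finitely many nonzero digits, and no two consecutive digits both equal to $1$. $[x]$ denotes the integer part of $x$. Stochastic Fibonacci adding machine: let $\overline{p}=(p_i)_{i\geq 1}\subset\,]0,1]$. It is the Markov chain on $\mathbb{N}$ whose one-step transition from a state $N$ with digits $\varepsilon_i=\varepsilon_i(N)$ is as follows. Draw independent random variables $(e_i)_{i\geq 0}$ with $e_i=1$ with probability $p_{i+1}$ and $e_i=0$ with probability $1-p_{i+1}$ (drawn afresh at each step). Put $c_{-1}=1$. The new state is $N'=\sum_i\varepsilon'_iF_i$, where: (a) if $\varepsilon_0=0$, then for all $i\geq 0$: $\varepsilon'_{2i}=\left[\frac{\varepsilon_{2i}+e_ic_{i-1}}{e_i\varepsilon_{2i+1}c_{i-1}+1}\right]$, $\varepsilon'_{2i+1}=\left[\frac{\varepsilon_{2i+1}}{e_ic_{i-1}+1}\right]$, $c_i=e_ic_{i-1}\varepsilon_{2i+1}$; (b) if $\varepsilon_0=1$, then $\varepsilon'_0=\left[\frac{1}{e_0+1}\right]$,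 $c_0=e_0$, and for all $i\geq 1$: $\varepsilon'_{2i-1}=\left[\frac{\varepsilon_{2i-1}+e_ic_{i-1}}{e_i\varepsilon_{2i}c_{i-1}+1}\right]$, $\varepsilon'_{2i}=\left[\frac{\varepsilon_{2i}}{e_ic_{i-1}+1}\right]$, $c_i=e_ic_{i-1}\varepsilon_{2i}$. The chain is called transient if every state is transient (the probability of ever returning to it is less than $1$). *)

(* Defs.v *)
From mathcomp Require Import all_boot all_order all_algebra.
From mathcomp Require Import finmap zify.
From mathcomp Require Import all_classical all_reals all_analysis.

Set Implicit Arguments.
Unset Strict Implicit.
Unset Printing Implicit Defensive.

Import Order.TTheory GRing.Theory Num.Theory.

Local Open Scope nat_scope.

(* Shifted convention: F_0 = 1 and F_1 = 2. *)
Fixpoint fib (n : nat) : nat :=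
  match n with
  | 0 => 1
  | m.+1 => match m with 0 => 2 | k.+1 => fib m + fib k end
  end.

Arguments fib : simpl nomatch.

Definition fib_expansion (N : nat) (a : nat -> nat) : Prop :=
  [/\ forall i, a i <= 1,
      forall i, ~ (a i = 1 /\ a i.+1 = 1) &
      exists n, (forall i, n <= i -> a i = 0) /\ N = \sum_(i < n) a i * fib i].

(* Greedy expansion of N using F_0, ..., F_(n-1); valid when N < F_n. *)
Fixpoint greedy (n N : nat) : nat -> nat :=
  match n with
  | 0 => fun=> 0
  | m.+1 => if fib m <= N then fun i => if i == m then 1 else greedy m (N - fib m) i
            else greedy m N
  end.

(* The i-th Fibonacci digit of N; see fib_digitP and fib_expansion_uniq. *)
Definition fib_digit (N i : nat) : nat := greedy N N i.

Lemma fib2 n : fib n.+2 = fib n.+1 + fib n.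
Proof. by []. Qed.

Lemma ltn_fib n : n < fib n.
Proof.
suff: n < fib n /\ n.+1 < fib n.+1 by case.
elim: n => [|n [IH1 IH2]]; first by [].
split=> //; rewrite fib2; lia.
Qed.

Lemma greedy_out n N i : n <= i -> greedy n N i = 0.
Proof.
elim: n N => [//|m IH] N /= mi; case: ifP => _; last by apply: IH; lia.
by case: eqP => [E|_]; [lia | apply: IH; lia].
Qed.

Lemma greedy_small n N k : N < fib k -> k <= n -> forall i, k <= i ->
  greedy n N i = 0.
Proof.
have fib_mono a b : a <= b -> fib a <= fib b.
  elim: b => [|b IH]; first by rewrite leqn0 => /eqP ->.
  rewrite leq_eqVlt => /orP[/eqP -> //|/IH/leq_trans]; apply.
  by case: b {IH} => [//|b]; rewrite fib2 leq_addr.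
move=> Nk; elim: n => [//|m IH] kn i ki.
case: (leqP k m) => km; last by apply: greedy_out; lia.
by rewrite /= leqNgt (leq_trans Nk (fib_mono _ _ km)) /=; apply: IH.
Qed.

Lemma greedyP n N : N < fib n ->
  [/\ forall i, greedy n N i <= 1,
      forall i, ~ (greedy n N i = 1 /\ greedy n N i.+1 = 1) &
      N = \sum_(i < n) greedy n N i * fib i].
Proof.
elim: n N => [|m IH] N.
  by rewrite big_ord0 /=; case: N => // _; split=> // i [].
move=> Nm; case: (leqP (fib m) N) => mN; last first.
  have [a b c] := IH _ mN.
  rewrite /= leqNgt mN /=; split=> //.
  by rewrite big_ord_recr /= greedy_out // mul0n addn0.
have NF : N - fib m < fib m.
  by case: m Nm mN {IH} => [|[|m]]; rewrite ?fib2 /=; lia.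
have [a b c] := IH _ NF.
rewrite /= mN; split.
- by move=> i; case: eqP.
- move=> i; case: (eqVneq i m) => [->|im].
    by rewrite gtn_eqF // greedy_out // => -[].
  case: (eqVneq i.+1 m) => [E|_]; last exact: b.
  rewrite (greedy_small (k := i)) ?leqnn //; last by lia.
    by case.
  by move: Nm mN; rewrite -E fib2; lia.
- rewrite big_ord_recr /= eqxx mul1n.
  rewrite (eq_bigr (fun i : 'I_m => greedy m (N - fib m) i * fib i)).
    by rewrite -c subnK.
  by move=> i _; rewrite ltn_eqF.
Qed.

Lemma fib_digitP N : fib_expansion N (fib_digit N).
Proof.
have [a b c] := greedyP (ltn_fib N).
by split=> //; exists N; split=> // i; apply: greedy_out.
Qed.

Lemma fib_digit_out N i : N <= i -> fib_digit N i = 0.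
Proof. exact: greedy_out. Qed.

Lemma fib_expansion_uniq N a b :
  fib_expansion N a -> fib_expansion N b -> a =1 b.
Proof.
pose S (c : nat -> nat) n := \sum_(i < n) c i * fib i.
have SS c n : S c n.+1 = S c n + c n * fib n by rewrite /S big_ord_recr.
have S0 c : S c 0 = 0 by rewrite /S big_ord0.
have bound (c : nat -> nat) : (forall i, c i <= 1) ->
    (forall i, ~ (c i = 1 /\ c i.+1 = 1)) -> forall n, S c n < fib n.
  move=> c1 c2 n; suff: S c n < fib n /\ S c n.+1 < fib n.+1 by case.
  elim: n => [|n [IH1 IH2]].
    by rewrite SS S0 /=; have := c1 0; lia.
  split=> //; rewrite fib2 SS.
  have := c1 n.+1; have := c1 n; have := @c2 n.
  case: (c n.+1) => [|[|//]] h1 h2 _; first by lia.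
  have cn : c n = 0 by case: (c n) h1 h2 => [|[|]] //= h _; case: h.
  by move: IH2; rewrite SS cn; lia.
have uniq n : forall a b : nat -> nat,
    (forall i, a i <= 1) -> (forall i, ~ (a i = 1 /\ a i.+1 = 1)) ->
    (forall i, b i <= 1) -> (forall i, ~ (b i = 1 /\ b i.+1 = 1)) ->
    S a n = S b n -> forall i, i < n -> a i = b i.
  elim: n => [//|n IH] {}a {}b a1 a2 b1 b2.
  rewrite !SS => E.
  have Ba := bound a a1 a2 n; have Bb := bound b b1 b2 n.
  have En : a n = b n.
    by move: E (a1 n) (b1 n); case: (a n) => [|[|//]]; case: (b n) => [|[|//]];
      lia.
  move=> i; rewrite ltnS leq_eqVlt => /orP[/eqP -> //|].
  by apply: (IH a b) => //; move: E; rewrite En; lia.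
move=> [a1 a2 [n [an Na]]] [b1 b2 [m [bm Nb]]] i.
have ext (c : nat -> nat) k l : (forall i, k <= i -> c i = 0) -> k <= l ->
    S c l = S c k.
  move=> ck; elim: l => [|l IH]; first by rewrite leqn0 => /eqP ->.
  rewrite leq_eqVlt => /orP[/eqP -> //|kl].
  by rewrite SS ck ?mul0n ?addn0 ?IH.
apply: (uniq (maxn (maxn n m) i.+1)) => //; last by lia.
by rewrite (ext a n) ?(ext b m) /S -?Na -?Nb //; lia.
Qed.

(* One step of the machine from the state N, with draws e. The carries are
   shifted by one: carry N e i stands for c_(i-1), so that carry N e 0 is
   c_(-1) = 1. *)
Section Step.
Variables (N : nat) (e : nat -> bool).
Local Notation eps := (fib_digit N).

Fixpoint carry (i : nat) : nat :=
  match i with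
  | 0 => 1
  | j.+1 =>
      if eps 0 == 0 then e j * carry j * eps (j.*2.+1)
      else if j == 0 then nat_of_bool (e 0)
      else e j * carry j * eps j.*2
  end.

(* The digits eps'_k: when eps_0 = 0, k = 2i or 2i+1 with i = k./2; when
   eps_0 = 1 and k > 0, k = 2i-1 or 2i with i = uphalf k. *)
Definition step_digit (k : nat) : nat :=
  if eps 0 == 0 then
    let i := k./2 in
    if odd k then eps k %/ (e i * carry i + 1)
    else (eps k + e i * carry i) %/ (e i * eps k.+1 * carry i + 1)
  else if k == 0 then 1 %/ (e 0 + 1)
  else
    let i := uphalf k in
    if odd k then (eps k + e i * carry i) %/ (e i * eps k.+1 * carry i + 1)
    else eps k %/ (e i * carry i + 1).

(* All the digits beyond position N vanish, see step_digit_out. *)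
Definition step : nat := \sum_(k < N.+1) step_digit k * fib k.

Lemma step_digit_out k : N < k -> step_digit k = 0.
Proof.
move=> Nk; have ek : eps k = 0 by apply: fib_digit_out; lia.
have carry_out i : N < i.*2 -> eps 0 == 0 -> carry i = 0.
  case: i => // j Nj e0; rewrite /= e0 (@fib_digit_out _ j.*2.+1) ?muln0 //; lia.
have carry_out' i : N < i.*2.-1 -> eps 0 != 0 -> carry i = 0.
  case: i => // j Nj e0; rewrite /= (negbTE e0).
  case: eqP => [j0|_].
    have N0 : N = 0 by lia.
    by case/eqP: e0; apply: fib_digit_out; rewrite N0.
  by rewrite (@fib_digit_out _ j.*2) ?muln0 //; lia.
rewrite /step_digit ek; case: (boolP (eps 0 == 0)) => e0.
  have := odd_double_half k; case: ifP => ok kE; first by rewrite div0n.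
  by rewrite carry_out ?muln0 ?div0n //; lia.
rewrite gtn_eqF; last by lia.
have := odd_double_half k; case: ifP => ok kE; last by rewrite div0n.
by rewrite carry_out' ?muln0 ?div0n //; rewrite uphalf_half ok; lia.
Qed.

End Step.

Local Open Scope classical_set_scope.
Local Open Scope ring_scope.

Definition mutually_independent d d' (T : measurableType d)
    (T' : measurableType d') (R : realType) (P : probability T R)
    (I : choiceType) (X : I -> {RV P >-> T'}) : Prop :=
  forall (J : {fset I}) (A : I -> set T'),
    (forall i, i \in J -> measurable (A i)) ->
    P (\bigcap_(i in [set` J]) (X i @^-1` A i)) =
    (\prod_(i <- J) P (X i @^-1` A i))%E.

(* e (t, i) is the draw e_i used in the t-th step; all of them are mutually
   independent, and e_i = 1 with probability p_(i+1). *)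
Definition fib_draws d (T : measurableType d) (R : realType)
    (P : probability T R) (p : nat -> R)
    (e : nat * nat -> {RV P >-> bool}) : Prop :=
  mutually_independent e /\
  forall t i, P [set w | e (t, i) w = true] = (p i.+1)%:E.

Section Chain.
Context d (T : measurableType d) (R : realType) (P : probability T R).
Variable e : nat * nat -> {RV P >-> bool}.

Fixpoint chain (N t : nat) (w : T) : nat :=
  match t with
  | 0 => N
  | s.+1 => step (chain N s w) (fun i => e (s, i) w)
  end.

Definition transient_state (N : nat) : Prop :=
  (P [set w | exists t, chain N t.+1 w = N] < 1)%E.

Definition transient_chain : Prop := forall N, transient_state N.

End Chain.

(* Main.v *)
Require Import Defs.
From mathcomp Require Import all_boot all_order all_algebra.
From mathcomp Require Import finmap zify lra ring.
From mathcomp Require Import all_classical all_reals all_analysis.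
Import Order.TTheory GRing.Theory Num.Theory numFieldNormedType.Exports.
Local Open Scope classical_set_scope.
Local Open Scope ring_scope.

(** From a state x whose first r slots (every second digit, starting from the
position forced by the parity of the units digit) are 1 and whose slot r is 0,
the step only looks at the length m of the initial run of successful draws,
capped at r.+1: it yields x + 1 if m = r.+1, and otherwise x minus the first m
slot digits, because the carry has erased them without being able to write the
next digit (step_up, step_down, stepE). So the transition law is explicit
(trans), with weights made of the products p_1 ... p_m.

Call level k the interval [F_k, F_(k+1)). A step from level k stays in level k,
except from its last state F_(k+1) - 1, where the digits alternate and
r = k/2 + 1: there the chain leaves upwards to F_(k+1), or it falls to 0, the
two having conditional probabilities q_k = p_(k/2+2) and 1 - q_k. Hence the
function equal to the product of the 1/q_j, j < k, on level k, and to 0 at 0, is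
harmonic at every x >= 1, and remains so above F_n when it is replaced by 0
below F_n (potential_harmonic). It is bounded exactly when the product of the
p_i is positive, since each p_i with i >= 2 occurs for two consecutive levels.

Let the taboo law be the law of the chain started at N at time t, on the event
that it has not come back to N up to time t; its total mass decreases to the
probability of never returning.
If the potential is bounded, take it truncated below F_N > N. It is subharmonic
and vanishes at N, so its integral against the taboo law does not decrease in
time; that integral is positive as soon as the chain has had time to climb to
F_N, hence the mass stays away from 0 (survival_lower).
If the potential is unbounded, take N = 0. Its integral against the taboo law is
constant from time 1 on, so by Markov's inequality little mass sits high up. The
mass lost at 0 in one step tends to 0, so when q_k < 1 the mass at F_(k+1) - 1
tends to 0, and then so does the mass at all smaller states, since each
feeds its successor. Such k exist arbitrarily far, and the mass tends to 0: the
state 0 is recurrent (survival_cvg0).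

The recursion satisfied by the taboo law comes from the independence of one draw
from any event that depends on finitely many other draws (bit_indep). *)

(** * One step of the machine *)
Section Step.
Local Open Scope nat_scope.
Implicit Types (x m k : nat) (e : nat -> bool).

Lemma fib_gt0 n : 0 < fib n.
Proof. by have := ltn_fib n; lia. Qed.

Lemma ltn_fibS n : fib n < fib n.+1.
Proof. by case: n => [//|n]; rewrite fib2; have := fib_gt0 n; lia. Qed.

Lemma leq_fib : {mono fib : m n / m <= n}.
Proof. by apply: leq_mono; apply: homo_ltn ltn_fibS; apply: ltn_trans. Qed.

Lemma ltn_fib2 : {mono fib : m n / m < n}.
Proof. exact: leqW_mono leq_fib. Qed.

Lemma fib_level x : 0 < x -> exists k, fib k <= x < fib k.+1.
Proof.
move=> x0; have ex : exists k, x < fib k.+1.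
  by exists x; rewrite (ltn_trans (ltn_fib x)) ?ltn_fibS.
exists (ex_minn ex); case: ex_minnP => -[|k] xk kmin; first by rewrite x0.
by rewrite xk andbT leqNgt; apply/negP => /kmin; rewrite ltnn.
Qed.

(** This is F_1 + F_3 + ... + F_(q-2) = F_(q-1) - 1, or its analogue with even
indices, according to the parity of q. It makes the effect of erasing the first
slots a single Fibonacci number. *)
Lemma fib_sum_parity q :
  (\sum_(k < q | odd k == odd q) fib k).+1 = fib q.-1.
Proof.
suff: (\sum_(k < q | odd k == odd q) fib k).+1 = fib q.-1 /\
      (\sum_(k < q.+1 | odd k == odd q.+1) fib k).+1 = fib q by case.
elim: q => [|q [IH1 IH2]].
  by split; rewrite ?big_mkcond ?big_ord_recr ?big_ord0.
split=> //; rewrite big_mkcond 2!big_ord_recr -big_mkcond /= !negbK eqxx.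
rewrite ifF; last by case: (odd q).
by case: q IH1 {IH2} => [|q] IH1; rewrite addn0 -addSn IH1 // fib2 addnC.
Qed.

Lemma fib_digit_le1 x i : fib_digit x i <= 1.
Proof. by case: (fib_digitP x). Qed.

Lemma fib_digit_adj x i : fib_digit x i.+1 = 1 -> fib_digit x i = 0.
Proof.
move=> ei; have := fib_digit_le1 x i; case: (fib_digitP x) => _ /(_ i) h _.
by case: (fib_digit x i) h => [|[|]] // [].
Qed.

Lemma fib_digit_sum x n : x <= n -> \sum_(i < n) fib_digit x i * fib i = x.
Proof.
move=> xn; have [_ _ [n0 [out {2}->]]] := fib_digitP x.
pose f i := fib_digit x i * fib i.
have ext a b : a <= b -> (forall i, a <= i -> f i = 0) ->
    \sum_(i < b) f i = \sum_(i < a) f i.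
  move=> ab fa; rewrite -(subnKC ab) big_split_ord /= [X in _ + X]big1 ?addn0 //.
  by move=> i _; rewrite fa // leq_addr.
rewrite -(ext n0 (maxn n n0)) ?leq_maxr//; last by move=> i /out; rewrite /f => ->.
rewrite (ext n (maxn n n0)) ?leq_maxl// => i ni.
by rewrite /f fib_digit_out // (leq_trans xn).
Qed.

(** The positions whose digits feed the carry: the odd ones if the units digit
is 0, the even ones if it is 1. *)
Definition slot x i := (fib_digit x 0 == 0) + i.*2.

Definition run x := find (fun i => fib_digit x (slot x i) == 0) (iota 0 x.+1).

(** The sum of the Fibonacci numbers at the first m slots, see
[fib_sum_parity] and [leq_fall]; it is 0 when m = 0, also if slot x 0 = 0. *)
Definition fall x m := (fib (slot x m).-1).-1.

Lemma odd_slot x m : odd (slot x m) = (fib_digit x 0 == 0).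
Proof. by rewrite /slot oddD odd_double addbF; case: eqP. Qed.

Lemma has_run x : has (fun i => fib_digit x (slot x i) == 0) (iota 0 x.+1).
Proof.
apply/hasP; exists x; first by rewrite mem_iota /= ltnSn.
by rewrite fib_digit_out // /slot -addnn; lia.
Qed.

Lemma run_le x : run x <= x.
Proof. by have := has_run x; rewrite has_find size_iota. Qed.

Lemma digit_lt_run x i : i < run x -> fib_digit x (slot x i) = 1.
Proof.
move=> ir; have := before_find 0 ir; rewrite nth_iota; last first.
  by have := run_le x; lia.
by have := fib_digit_le1 x (slot x i); rewrite add0n; case: (fib_digit _ _) => [|[]].
Qed.

Lemma digit_run x : fib_digit x (slot x (run x)) = 0.
Proof.
have := nth_find 0 (has_run x); rewrite nth_iota; last first.
  by have := run_le x; rewrite /run; lia.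
by move/eqP.
Qed.

(** The two cases of the definition of the machine agree once the digits that
feed the carry are indexed by slots. *)
Lemma carryS x e i :
  carry x e i.+1 = e i * carry x e i * fib_digit x (slot x i).
Proof.
rewrite /= /slot; case: eqP => [//|/eqP e0].
case: eqP => [->|//] /=.
by have := fib_digit_le1 x 0; case: (fib_digit x 0) e0 => [|[]]// _ _; rewrite !muln1.
Qed.

(** Throughout this section m is the index at which the carry dies: either the
draw e m fails, or slot m holds a 0 that absorbs the carry. *)
Section Stop.
Variables (x : nat) (e : nat -> bool) (m : nat).
Hypotheses (m_run : m <= run x) (e_lt : forall i, i < m -> e i)
  (e_m : e m -> m = run x).

Lemma carry_stop i : carry x e i = (i <= m).
Proof.
have le i' : i' <= m -> carry x e i' = 1.
  elim: i' => [//|i' IH] im; rewrite carryS e_lt // IH ?(ltnW im) //.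
  by rewrite digit_lt_run // (leq_trans im).
case: (leqP i m) => [/le //|]; case: i => [//|i]; rewrite ltnS.
elim: i => [|i IH] im.
  have m0 : m = 0 by lia.
  rewrite carryS -m0; case: (boolP (e m)) => [/e_m->|]; last by rewrite !mul0n.
  by rewrite digit_run muln0.
case: (ltngtP i.+1 m) im => // [im _|im _]; first by rewrite carryS IH ?muln0.
rewrite carryS im; case: (boolP (e m)) => [/e_m->|]; last by rewrite !mul0n.
by rewrite digit_run muln0.
Qed.

(** The step clears the slots before slot m and, if draw m succeeds, writes a 1
just before slot m. Moving the cleared digits to the left-hand side avoids
truncated subtraction when this is summed over k. *)
Lemma step_digit_stop k :
  step_digit x e k + ((k < slot x m) && (odd k == odd (slot x m))) =
  fib_digit x k + (e m && (k.+1 == slot x m)).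
Proof.
have d1 := fib_digit_le1 x.
have dm : e m -> fib_digit x (slot x m) = 0 by move=> /e_m ->; apply: digit_run.
have dlt i : i < m -> fib_digit x (slot x i) = 1.
  by move=> im; apply: digit_lt_run; apply: leq_trans m_run.
rewrite /step_digit odd_slot !carry_stop; rewrite /slot in dm dlt *.
have kE := odd_double_half k.
have uE := odd_double_half k.+1.
(* In each parity case, position k either is a slot or precedes one; i is the
   index of that slot and it is compared to m. *)
case: (eqVneq (fib_digit x 0) 0) => e0; rewrite ?e0 /= in dm dlt *.
  case: (boolP (odd k)) kE => /= ok kE; case: (ltngtP k./2 m) => im.
  - have D := dlt _ im; rewrite kE in D; rewrite e_lt // D; lia.
  - rewrite muln0 divn1; lia.
  - rewrite im muln1; case: (boolP (e m)) => em; last by rewrite divn1; lia.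
    by have := dm em; rewrite -im kE => ->; lia.
  - have D := dlt _ im; have kS : 1 + k./2.*2 = k.+1 by lia.
    by rewrite kS in D; rewrite e_lt // D (fib_digit_adj _ _ D); lia.
  - rewrite !muln0 divn1; lia.
  - have kS : 1 + m.*2 = k.+1 by lia.
    rewrite im kS muln1; case: (boolP (e m)) => em; last by rewrite divn1; lia.
    by have := dm em; rewrite kS => ->; rewrite divn1; lia.
have e01 : fib_digit x 0 = 1 by have := d1 0; lia.
rewrite (negbTE e0) /= in dm dlt.
case: (eqVneq k 0) => [->|k0] /=.
  rewrite e01; case: (posnP m) => [m0|m0]; last by rewrite e_lt //=; lia.
  rewrite m0 in dm *; case: (boolP (e 0)) => em /=; last by [].
  by have := dm em; rewrite addn0 e01.
case: (boolP (odd k)) kE uE => /= ok kE uE; rewrite uphalfE in uE *.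
  case: (ltngtP (k.+1)./2 m) => im.
  - have D := dlt _ im; have kS : 0 + (k.+1)./2.*2 = k.+1 by lia.
    by rewrite kS in D; rewrite e_lt // D (fib_digit_adj _ _ D); lia.
  - rewrite !muln0 divn1; lia.
  - have kS : 0 + m.*2 = k.+1 by lia.
    rewrite im kS muln1; case: (boolP (e m)) => em; last by rewrite divn1; lia.
    by have := dm em; rewrite kS => ->; rewrite divn1; lia.
have -> : (k.+1)./2 = k./2 by lia.
case: (ltngtP k./2 m) => im.
- have D := dlt _ im; have kS : 0 + k./2.*2 = k by lia.
  by rewrite kS in D; rewrite e_lt // D; lia.
- rewrite muln0 divn1; lia.
- have kS : 0 + m.*2 = k by lia.
  rewrite im kS muln1; case: (boolP (e m)) => em; last by rewrite divn1; lia.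
  by have := dm em; rewrite kS => ->; lia.
Qed.

Lemma step_stop_sum :
  step x e + fall x m = x + (if e m then fib (slot x m).-1 else 0).
Proof.
(* The bound n covers both the digits of x and the erased slots. *)
set n := maxn x.+1 (slot x m).
have stepE : step x e = \sum_(k < n) step_digit x e k * fib k.
  rewrite /step /n -(subnKC (leq_maxl x.+1 (slot x m))) big_split_ord /=.
  rewrite [X in _ + X]big1 ?addn0 // => i _.
  by rewrite step_digit_out ?mul0n // leq_addr.
have fallE : fall x m =
    \sum_(k < n) ((k < slot x m) && (odd k == odd (slot x m))) * fib k.
  rewrite /fall -fib_sum_parity /= [RHS](bigID (fun k : 'I_n => k < slot x m)) /=.
  rewrite [X in _ + X]big1 ?addn0; last by move=> i /negbTE ->.
  rewrite (big_ord_widen_cond n (fun k => odd k == odd (slot x m)) fib) ?leq_maxr //.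
  rewrite big_mkcond [RHS]big_mkcond; apply: eq_bigr => i _.
  by case: (_ < _); case: (odd i == _); rewrite //= ?mul1n ?mul0n.
rewrite stepE fallE -big_split /=.
under eq_bigr do rewrite -mulnDl step_digit_stop mulnDl.
rewrite big_split /= fib_digit_sum; last by rewrite (leq_trans (leqnSn x)) ?leq_maxl.
congr addn; case: (boolP (e m)) => em; last by rewrite big1.
have s0 : 0 < slot x m.
  case: (posnP (slot x m)) => // s0; have := s0; rewrite /slot.
  have := digit_run x; rewrite -(e_m em) s0 => ->; lia.
have sn : (slot x m).-1 < n by rewrite prednK // leq_maxr.
rewrite (bigD1 (Ordinal sn)) //= prednK // eqxx mul1n big1 ?addn0 // => i ni.
case: eqP => [E|_]; last by rewrite ?andbF.
by case/eqP: ni; apply: val_inj; rewrite /= -E.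
Qed.

End Stop.

Lemma step_up x e : (forall i, i <= run x -> e i) -> step x e = x.+1.
Proof.
move=> eT; have := @step_stop_sum x e (run x) (leqnn _) (fun i h => eT i (ltnW h))
  (fun _ => erefl).
by rewrite eT // /fall; have := fib_gt0 (slot x (run x)).-1; lia.
Qed.

Lemma step_down x e m : m <= run x -> (forall i, i < m -> e i) -> ~~ e m ->
  step x e = x - fall x m.
Proof.
move=> mr eT em; have stop : e m -> m = run x by rewrite (negbTE em).
by have := step_stop_sum x e m mr eT stop; rewrite (negbTE em) addn0; lia.
Qed.

Section Level.
Variables (x k : nat).
Hypothesis x_k : fib k <= x < fib k.+1.

Lemma level_lt : k < x.
Proof. by case/andP: x_k => kx _; apply: leq_trans (ltn_fib k) kx. Qed.

Lemma digit_above i : k < i -> fib_digit x i = 0.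
Proof. by case/andP: x_k => _ xk; apply: greedy_small xk level_lt i. Qed.

Lemma digit_top : fib_digit x k = 1.
Proof.
have: k < x := level_lt; rewrite /fib_digit; move: {1 2}x => n.
elim: n => [//|n IH]; rewrite ltnS leq_eqVlt => /orP[/eqP <-|kn] /=.
  by case/andP: x_k => -> _; rewrite eqxx.
case/andP: (x_k) => _ xk; rewrite leqNgt (leq_trans xk) ?leq_fib //=.
exact: IH.
Qed.

Lemma leq_fall m : m <= run x ->
  fall x m <= \sum_(i < slot x m) fib_digit x i * fib i.
Proof.
move=> mr; rewrite /fall -fib_sum_parity /= big_mkcond /=.
apply: leq_sum => -[i im] _ /=; case: eqP => //; rewrite odd_slot => oi.
have iE : slot x (i./2) = i by rewrite /slot -oi odd_double_half.
rewrite -{2}iE digit_lt_run ?mul1n // (leq_trans _ mr) //.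
by move: im; rewrite -{1}iE /slot; lia.
Qed.

(** Subtracting the first m slot digits keeps the top digit k, unless it is
itself one of these slots; then all the digits of x are slots, they alternate
from the top downwards, and nothing remains. *)
Lemma fallP m : m <= run x ->
  fib k <= x - fall x m \/ [/\ x.+1 = fib k.+1, m = k./2.+1 & fall x m = x].
Proof.
move=> mr; have := leq_fall m mr.
case: (leqP (slot x m) k) => mk h.
  left; have : \sum_(i < k.+1) fib_digit x i * fib i <= x.
    rewrite -{2}(fib_digit_sum x x) //; rewrite -(subnKC level_lt) big_split_ord /=.
    exact: leq_addr.
  rewrite big_ord_recr /= digit_top mul1n => kx.
  have: fall x m <= \sum_(i < k) fib_digit x i * fib i.
    by apply: leq_trans h _; rewrite -(subnKC mk) [X in _ <= X]big_split_ord leq_addr.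
  by move: kx; move: (\sum_(i < k) _) => s; lia.
right; case: m mr mk h => [|m] mr mk h.
  have k0 : k = 0 by move: mk; rewrite /slot; lia.
  by move: mk; rewrite /slot -{1}k0 digit_top.
have sE : slot x m.+1 = (slot x m).+2 by rewrite /slot doubleS !addnS.
have dm := digit_lt_run x m mr.
(* The last erased slot holds a 1, so it is at most k; it cannot be k - 1 since
   two consecutive digits are not both 1. *)
have mk' : slot x m <= k.
  by rewrite leqNgt; apply/negP => /digit_above; rewrite dm.
have kE : k = slot x m.
  apply/eqP; rewrite eqn_leq mk' andbT -ltnS ltn_neqAle -ltnS -sE mk andbT.
  apply/eqP => kE; have := fib_digit_adj x (slot x m).
  by rewrite -kE digit_top dm => /(_ erefl).
have fE : fall x m.+1 = (fib k.+1).-1 by rewrite /fall sE kE.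
have F0 := fib_gt0 k.+1.
have fx : fall x m.+1 <= x.
  apply: leq_trans h _; rewrite -[X in _ <= X](fib_digit_sum x (slot x m.+1 + x)) ?leq_addl //.
  by rewrite [X in _ <= X]big_split_ord leq_addr.
have km : m = k./2.
  by rewrite kE /slot; case: (_ == _); rewrite ?uphalf_double ?doubleK //= uphalf_double.
split; [|by rewrite km|]; by case/andP: x_k; lia.
Qed.

End Level.

(** The expansion of F_(k+1) - 1 has ones exactly at k, k - 2, k - 4, ...; so all
its digits are slots and they are all erased by a carry that fails last. *)
Lemma run_fall_top k :
  run (fib k.+1).-1 = k./2.+1 /\ fall (fib k.+1).-1 k./2.+1 = (fib k.+1).-1.
Proof.
set x := (fib k.+1).-1.
pose a j : nat := (j <= k) && (odd j == odd k).
have xa : fib_expansion x a.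
  split; [by move=> j; rewrite /a; case: (_ && _) | |].
    by move=> j []; rewrite /a /=; case: (odd j); case: (odd k); lia.
  exists k.+1; split; first by move=> j kj; rewrite /a leqNgt kj.
  rewrite /x -[k.+1]/(k.+2.-1) -fib_sum_parity /= negbK big_mkcond big_ord_recr /=.
  rewrite ifF; last by case: (odd k).
  rewrite addn0; apply: eq_bigr => i _; rewrite /a -ltnS ltn_ord /=.
  by case: (_ == _); rewrite ?mul1n ?mul0n.
have dE := fib_expansion_uniq (fib_digitP x) xa.
have sE i : slot x i = odd k + i.*2 by rewrite /slot dE /a /=; case: (odd k).
have aE i : fib_digit x (slot x i) = (i <= k./2).
  rewrite dE /a sE oddD odd_double addbF oddb eqxx andbT; congr nat_of_bool.
  by have := odd_double_half k; lia.
split.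
  have := digit_run x; rewrite aE.
  case: (ltngtP (run x) k./2.+1) => //; first by lia.
  by move/digit_lt_run; rewrite aE; lia.
by rewrite /fall sE doubleS !addnS odd_double_half.
Qed.

(** The number of successful draws before the first failure, capped at
(run x).+1: this is all that the step from x uses of the draws. *)
Definition stop x e := find (fun i => ~~ e i) (iota 0 (run x).+1).

Definition land x m := if m <= run x then x - fall x m else x.+1.

Lemma stop_le x e : stop x e <= (run x).+1.
Proof. by rewrite -[X in _ <= X](size_iota 0) find_size. Qed.

Lemma leq_stop x e m : m <= (run x).+1 -> (m <= stop x e) = all e (iota 0 m).
Proof.
move=> mr; apply/idP/allP => [ms i|em].
  rewrite mem_iota add0n => /= im; have is_ := leq_trans im ms.
  have := before_find 0 is_; rewrite nth_iota ?(leq_trans im mr) //.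
  by rewrite add0n => /negbFE.
rewrite leqNgt; apply/negP => sm.
have sr : stop x e < (run x).+1 by apply: leq_trans sm mr.
have := nth_find 0 (a := fun i => ~~ e i) (s := iota 0 (run x).+1).
rewrite has_find size_iota -/(stop x e) nth_iota // => /(_ sr).
by rewrite add0n em // mem_iota.
Qed.

Lemma stepE x e : step x e = land x (stop x e).
Proof.
have := stop_le x e; rewrite leq_eqVlt /land => /orP[/eqP sE|sr].
  rewrite sE ltnn step_up // => i ir.
  have: (run x).+1 <= stop x e by rewrite sE.
  by rewrite leq_stop // => /allP; apply; rewrite mem_iota.
rewrite -ltnS sr; apply: step_down => //.
  move=> i is_; have := leqnn (stop x e); rewrite leq_stop ?(ltnW sr) //.
  by move/allP; apply; rewrite mem_iota.
apply/negP => es; have := ltnn (stop x e); rewrite leq_stop // -addn1 iotaD all_cat.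
by rewrite -(leq_stop x) ?(ltnW sr) // leqnn /= es.
Qed.

Lemma eq_step x e e' : (forall i, i <= x -> e i = e' i) -> step x e = step x e'.
Proof.
move=> ee; rewrite !stepE; congr land; apply: eq_in_find => i.
by rewrite mem_iota => /andP[_ ir]; rewrite ee //; have := run_le x; lia.
Qed.

Lemma land_le x m : land x m <= x.+1.
Proof. by rewrite /land; case: ifP => // _; lia. Qed.

End Step.

(** * Transition law and potential *)
Section Potential.
Context {R : realType}.
Variable p : nat -> R.
Hypothesis p01 : forall i, (1 <= i)%N -> 0 < p i <= 1.
Implicit Types (x y m k n t N : nat) (f : nat -> R).

Definition run_prob m := \prod_(i < m) p i.+1.

Lemma run_probS m : run_prob m.+1 = run_prob m * p m.+1.
Proof. by rewrite /run_prob big_ord_recr. Qed.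

Lemma run_prob_gt0 m : 0 < run_prob m.
Proof. by apply: prodr_gt0 => i _; case/andP: (p01 i.+1 isT). Qed.

Lemma run_prob_decr m : run_prob m.+1 <= run_prob m.
Proof.
by rewrite run_probS ler_piMr ?(ltW (run_prob_gt0 m)) //; case/andP: (p01 m.+1 isT).
Qed.

(** The probability that [stop] takes the value m. *)
Definition weight x m :=
  if (m <= run x)%N then run_prob m - run_prob m.+1 else run_prob m.

Lemma weight_ge0 x m : 0 <= weight x m.
Proof.
by rewrite /weight; case: ifP => _; rewrite ?subr_ge0 ?run_prob_decr ?ltW ?run_prob_gt0.
Qed.

Lemma sum_weight x m : (m <= (run x).+1)%N ->
  \sum_(i < m) weight x i = 1 - run_prob m.
Proof.
elim: m => [|m IH] mr; first by rewrite big_ord0 /run_prob big_ord0 subrr.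
by rewrite big_ord_recr IH ?(ltnW mr) //= /weight -ltnS mr; ring.
Qed.

Lemma sum_weight1 x : \sum_(m < (run x).+2) weight x m = 1.
Proof. by rewrite big_ord_recr sum_weight //= /weight ltnn; ring. Qed.

Definition trans x y := \sum_(m < (run x).+2) weight x m * (land x m == y)%:R.

Definition trans_op f x := \sum_(m < (run x).+2) weight x m * f (land x m).

Lemma trans_ge0 x y : 0 <= trans x y.
Proof. by apply: sumr_ge0 => m _; rewrite mulr_ge0 ?weight_ge0. Qed.

Lemma trans_out x y : (x.+1 < y)%N -> trans x y = 0.
Proof.
move=> xy; rewrite /trans big1 // => m _; rewrite ltn_eqF ?mulr0 //.
exact: leq_ltn_trans (land_le x m) xy.
Qed.

Lemma trans_opE f x n : (x.+1 < n)%N ->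
  \sum_(y < n) trans x y * f y = trans_op f x.
Proof.
move=> xn; under eq_bigr do rewrite mulr_suml.
rewrite exchange_big; apply: eq_bigr => m _ /=.
have ln : (land x m < n)%N by apply: leq_ltn_trans (land_le x m) xn.
rewrite (bigD1 (Ordinal ln)) //= eqxx mulr1 big1 ?addr0 // => i ni.
case: eqP => [E|_]; last by rewrite mulr0 mul0r.
by case/eqP: ni; apply: val_inj; rewrite /= -E.
Qed.

Lemma trans_up_gt0 x : 0 < trans x x.+1.
Proof.
rewrite /trans big_ord_recr /= {2}/land ltnn eqxx mulr1 /weight ltnn.
by rewrite ltr_wpDl ?run_prob_gt0 // sumr_ge0 // => m _; rewrite mulr_ge0 ?weight_ge0.
Qed.

(** One way to fall from the top of level k to 0 is that the first k/2 + 1 draws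
succeed and the next one fails. *)
Lemma trans_top0 k :
  run_prob k./2.+1 - run_prob k./2.+2 <= trans (fib k.+1).-1 0.
Proof.
have [rE fE] := run_fall_top k; set x := (fib k.+1).-1 in rE fE *.
have lE : land x k./2.+1 = 0%N by rewrite /land rE leqnn fE subnn.
have wE : weight x k./2.+1 = run_prob k./2.+1 - run_prob k./2.+2.
  by rewrite /weight rE leqnn.
rewrite /trans rE 2!big_ord_recr /= lE wE eqxx mulr1.
rewrite -addrA addrCA lerDl addr_ge0 ?mulr_ge0 ?weight_ge0 //.
by apply: sumr_ge0 => m _; rewrite mulr_ge0 ?weight_ge0.
Qed.

(** p (j/2 + 2) is the conditional probability of leaving level j upwards rather
than by a fall to 0. *)
Definition level_potential k := \prod_(j < k) (p (j./2.+2))^-1.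

Lemma level_potentialS k :
  level_potential k.+1 = level_potential k * (p (k./2.+2))^-1.
Proof. by rewrite /level_potential big_ord_recr. Qed.

Lemma level_potential_gt0 k : 0 < level_potential k.
Proof.
by apply: prodr_gt0 => j _; rewrite invr_gt0; case/andP: (p01 (j./2.+2) isT).
Qed.

Lemma level_potential_homo : {homo level_potential : k l / (k <= l)%N >-> k <= l}.
Proof.
apply: homo_leq => [//|? ? ?|k]; first exact: le_trans.
rewrite level_potentialS ler_peMr ?(ltW (level_potential_gt0 k)) //.
by rewrite invf_ge1; case/andP: (p01 (k./2.+2) isT).
Qed.

(** On level k >= n this is [level_potential k], as F_(j+1) <= x amounts to
j < k; writing it as a filtered product avoids naming the level of x. *)
Definition potential n x :=
  if (x < fib n)%N then 0 else \prod_(j < x | (fib j.+1 <= x)%N) (p (j./2.+2))^-1.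

Lemma potential_level n x k : (n <= k)%N -> (fib k <= x < fib k.+1)%N ->
  potential n x = level_potential k.
Proof.
move=> nk xk; have kx := level_lt _ _ xk; case/andP: (xk) => kx' xk'.
rewrite /potential ltnNge (leq_trans _ kx') ?leq_fib //=.
rewrite /level_potential (big_ord_widen x (fun j => (p (j./2.+2))^-1)) ?(ltnW kx) //.
apply: eq_bigl => j; apply/idP/idP => jx; last first.
  by rewrite (leq_trans _ kx') // leq_fib.
by rewrite -ltnS -ltn_fib2 (leq_ltn_trans jx).
Qed.

Lemma potential_lt n x : (x < fib n)%N -> potential n x = 0.
Proof. by rewrite /potential => ->. Qed.

Lemma fib_level_ge n x : (fib n <= x)%N ->
  exists2 k, (n <= k)%N & (fib k <= x < fib k.+1)%N.
Proof.
move=> nx; have [|k xk] := fib_level x; first by rewrite (leq_trans _ nx) ?fib_gt0.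
by exists k => //; rewrite -ltnS -ltn_fib2 (leq_ltn_trans nx) //; case/andP: xk.
Qed.

Lemma potential_ge0 n x : 0 <= potential n x.
Proof.
case: (ltnP x (fib n)) => [/potential_lt->//|/fib_level_ge[k nk xk]].
by rewrite (potential_level _ _ _ nk xk) ltW ?level_potential_gt0.
Qed.

Lemma trans_op_const f x c : (forall m, (m <= (run x).+1)%N -> f (land x m) = c) ->
  trans_op f x = c.
Proof.
move=> fc; rewrite /trans_op; under eq_bigr => m _ do rewrite (fc m (leq_ord m)).
by rewrite -mulr_suml sum_weight1 mul1r.
Qed.

(** Inside a level the potential is constant and the step does not leave the
level. At its last state, with s = k/2 + 1, the step stays in the level with
probability 1 - P_s, falls to 0, where the potential vanishes, with probability
P_s - P_(s+1), and reaches the next level with probability P_s p_(s+1), where the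
potential is multiplied by 1 / p_(s+1). *)
Lemma potential_harmonic n x : (fib n <= x)%N ->
  trans_op (potential n) x = potential n x.
Proof.
case/fib_level_ge => k nk xk; rewrite (potential_level _ _ _ nk xk).
case/andP: (xk) => kx; rewrite leq_eqVlt => /orP[/eqP xE|xk']; last first.
  apply: trans_op_const => m mr; apply: (potential_level _ _ _ nk).
  rewrite /land; case: ifP => [{}mr|_]; last by rewrite xk' leqW.
  have [h|[xE _ _]] := fallP _ _ xk m mr; last by rewrite xE ltnn in xk'.
  by rewrite h (leq_ltn_trans (leq_subr _ _)) //; case/andP: xk.
have xE' : x = (fib k.+1).-1 by rewrite -xE.
have [rE fE] := run_fall_top k; rewrite -xE' in rE fE.
have l0 : land x k./2.+1 = 0%N by rewrite /land rE leqnn fE subnn.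
have l1 : land x k./2.+2 = fib k.+1 by rewrite /land rE ltnn.
have w1 : weight x k./2.+2 = run_prob k./2.+2 by rewrite /weight rE ltnn.
rewrite /trans_op rE 2!big_ord_recr /= l0 l1 w1.
rewrite potential_lt ?fib_gt0 // mulr0 addr0.
rewrite (potential_level _ _ k.+1) ?leqnn ?ltn_fibS ?leqW //.
rewrite (eq_bigr (fun m : 'I__ => weight x m * level_potential k)); last first.
  move=> m _; congr (_ * _); apply: (potential_level _ _ _ nk).
  rewrite /land rE (ltnW (ltn_ord m)).
  have mr : (m <= run x)%N by rewrite rE ltnW.
  have [h|[_ mE _]] := fallP _ _ xk m mr; last by have := ltn_ord m; rewrite mE ltnn.
  by rewrite h (leq_ltn_trans (leq_subr _ _)) //; case/andP: xk.
rewrite -mulr_suml sum_weight ?rE // level_potentialS (run_probS k./2.+1).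
have : p k./2.+2 != 0 by apply: lt0r_neq0; case/andP: (p01 k./2.+2 isT).
by move=> p0; field.
Qed.

(** The mass at y, at time t, of the chain started at N and killed when it comes
back to N. Summing up to N + t loses nothing, as a step adds at most 1. *)
Fixpoint taboo N t y : R :=
  match t with
  | 0 => (y == N)%:R
  | s.+1 => if y == N then 0 else \sum_(x < (N + s).+1) taboo N s x * trans x y
  end.

Definition taboo_sum N t f := \sum_(x < (N + t).+1) taboo N t x * f x.

Lemma taboo_ge0 N t y : 0 <= taboo N t y.
Proof.
elim: t y => [|t IH] y /=; first exact: ler0n.
by case: ifP => // _; apply: sumr_ge0 => x _; rewrite mulr_ge0 ?trans_ge0.
Qed.

Lemma taboo_out N t y : (N + t < y)%N -> taboo N t y = 0.
Proof.
elim: t y => [|t IH] y /=; first by move=> ?; rewrite gtn_eqF //; lia.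
move=> Ny; rewrite gtn_eqF; last by lia.
rewrite big1 // => x _; rewrite trans_out ?mulr0 //; have := ltn_ord x; lia.
Qed.

Lemma taboo_up N t x : x.+1 != N -> taboo N t x * trans x x.+1 <= taboo N t.+1 x.+1.
Proof.
move=> xN; case: (ltnP (N + t) x) => xt.
  by rewrite taboo_out // mul0r taboo_ge0.
rewrite /= (negbTE xN) (bigD1 (Ordinal (xt : (x < (N + t).+1)%N))) //= lerDl.
by apply: sumr_ge0 => y _; rewrite mulr_ge0 ?trans_ge0 ?taboo_ge0.
Qed.

(** The states N + t are reached by t consecutive increments, which never come
back to N. *)
Lemma taboo_climb_gt0 N t : 0 < taboo N t (N + t).
Proof.
elim: t => [|t IH]; first by rewrite /= addn0 eqxx.
rewrite addnS (lt_le_trans _ (taboo_up _ _ _ _)) ?mulr_gt0 ?trans_up_gt0 //; lia.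
Qed.

(** Killing at N costs nothing against a function that vanishes at N, so that the
evolution of the integral is governed by the transition operator alone. *)
Lemma taboo_sumS N t f : f N = 0 -> taboo_sum N t.+1 f = taboo_sum N t (trans_op f).
Proof.
move=> fN; rewrite /taboo_sum.
rewrite (eq_bigr (fun y : 'I__ => \sum_(x < (N + t).+1) taboo N t x * trans x y * f y)).
  rewrite exchange_big; apply: eq_bigr => x _.
  rewrite -(@trans_opE f x (N + t.+1).+1) ?mulr_sumr; last by have := ltn_ord x; lia.
  by apply: eq_bigr => y _; rewrite mulrA.
move=> y _ /=; case: eqP => [->|_]; last by rewrite mulr_suml.
by rewrite fN mulr0 big1 // => x _; rewrite mulr0.
Qed.

Lemma ler_taboo_sum N t f g : (forall x, f x <= g x) -> taboo_sum N t f <= taboo_sum N t g.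
Proof. by move=> fg; apply: ler_sum => x _; rewrite ler_wpM2l ?taboo_ge0. Qed.

Lemma taboo_term_le N t f x : (forall y, 0 <= f y) -> taboo N t x * f x <= taboo_sum N t f.
Proof.
move=> f0; case: (ltnP (N + t) x) => xt.
  by rewrite taboo_out // mul0r sumr_ge0 // => y _; rewrite mulr_ge0 ?taboo_ge0.
rewrite /taboo_sum (bigD1 (Ordinal (xt : (x < (N + t).+1)%N))) //= lerDl.
by apply: sumr_ge0 => y _; rewrite mulr_ge0 ?taboo_ge0.
Qed.

(** The probability of no return to N up to time t, see [avoids_prob]. *)
Definition survival N t := taboo_sum N t (fun=> 1).

Lemma survivalS N t :
  survival N t.+1 = survival N t - taboo_sum N t (fun x => trans x N).
Proof.
pose f x : R := (x != N)%:R.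
have -> : survival N t.+1 = taboo_sum N t.+1 f.
  apply: eq_bigr => x _; rewrite /f /=; case: eqP => _; last by rewrite mulr1.
  by rewrite !mul0r.
rewrite taboo_sumS /f ?eqxx // /survival /taboo_sum -sumrB; apply: eq_bigr => x _.
rewrite -mulrBr; congr (_ * _).
rewrite -[X in _ = X - _](sum_weight1 x) /trans_op /trans -sumrB; apply: eq_bigr => m _.
by case: eqP => _ /=; rewrite ?mulr1 ?mulr0 ?subrr ?subr0.
Qed.

Lemma survival_decr N t : survival N t.+1 <= survival N t.
Proof.
rewrite survivalS gerBl sumr_ge0 // => x _.
by rewrite mulr_ge0 ?taboo_ge0 ?trans_ge0.
Qed.

Lemma survival_homo N s t : (s <= t)%N -> survival N t <= survival N s.
Proof.
move=> st; rewrite -(subnKC st); elim: (t - s)%N => [|u IH]; first by rewrite addn0.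
by rewrite addnS (le_trans (survival_decr _ _)).
Qed.

Lemma survival_ge0 N t : 0 <= survival N t.
Proof. by apply: sumr_ge0 => x _; rewrite mulr1 taboo_ge0. Qed.

(** The potential truncated below F_N vanishes at N and is subharmonic, so its
integral against the taboo law is nondecreasing in time; it is at most G times
the total mass, and it is positive at the time F_N - N at which the chain can
have climbed to F_N. *)
Lemma survival_lower N G : (forall x, potential N x <= G) ->
  exists2 c, 0 < c & forall t, c <= survival N t.
Proof.
move=> bound; pose f := potential N.
have fN : f N = 0 by apply: potential_lt; apply: ltn_fib.
have G0 : 0 < G.
  apply: lt_le_trans (bound (fib N)).
  by rewrite (potential_level _ _ N) ?leqnn ?ltn_fibS ?level_potential_gt0.
have up t : taboo_sum N t f <= taboo_sum N t.+1 f.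
  rewrite taboo_sumS //; apply: ler_taboo_sum => x; case: (ltnP x (fib N)) => xN.
    rewrite /f potential_lt //; apply: sumr_ge0 => m _.
    by rewrite mulr_ge0 ?weight_ge0 ?potential_ge0.
  by rewrite /f potential_harmonic.
have ups s t : (s <= t)%N -> taboo_sum N s f <= taboo_sum N t f.
  move=> st; rewrite -(subnKC st); elim: (t - s)%N => [|u IH]; first by rewrite addn0.
  by rewrite addnS (le_trans IH).
pose t0 := (fib N - N)%N.
have t0E : (N + t0 = fib N)%N by rewrite subnKC // ltnW ?ltn_fib.
have pos : 0 < taboo_sum N t0 f.
  apply: lt_le_trans (taboo_term_le _ _ _ (fib N) (potential_ge0 N)).
  rewrite -{1}t0E mulr_gt0 ?taboo_climb_gt0 // /f (potential_level _ _ N) ?leqnn ?ltn_fibS //.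
  exact: level_potential_gt0.
exists (taboo_sum N t0 f / G); first by rewrite divr_gt0.
move=> t; apply: le_trans (survival_homo N t (maxn t t0) (leq_maxl _ _)).
rewrite ler_pdivrMr // (le_trans (ups _ _ (leq_maxr t t0))) //.
rewrite /survival /taboo_sum mulr_suml; apply: ler_sum => x _.
by rewrite mulr1 ler_wpM2l ?taboo_ge0.
Qed.

Lemma survival_cvg N : cvgn (survival N).
Proof.
apply: nonincreasing_is_cvgn; first by move=> s t; apply: survival_homo.
by exists 0 => _ [t _ <-]; apply: survival_ge0.
Qed.

(** The mass lost between t and t + 1 tends to 0, as the total mass decreases to
a limit; a fixed positive proportion of the mass at F_(k+1) - 1 is lost. *)
Lemma taboo_top_cvg0 k : p (k./2.+2) < 1 ->
  (taboo 0 t (fib k.+1).-1 @[t --> \oo] --> 0).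
Proof.
move=> pk; set x := (fib k.+1).-1.
pose c := run_prob k./2.+1 - run_prob k./2.+2.
have c0 : 0 < c.
  by rewrite subr_gt0 (run_probS k./2.+1) gtr_pMr ?run_prob_gt0.
pose d t := c^-1 * (survival 0 t - survival 0 t.+1).
have dcvg : d @ \oo --> 0.
  have S1 := survival_cvg 0.
  have S2 : survival 0 t.+1 @[t --> \oo] --> limn (survival 0).
    by rewrite cvg_shiftS.
  rewrite -[X in _ --> X](mulr0 c^-1) -[X in _ * X](subrr (limn (survival 0))).
  by apply: cvgM; [exact: cvg_cst | apply: cvgB].
apply: squeeze_cvgr (cvg_cst 0) dcvg; near=> t; rewrite taboo_ge0 /= /d survivalS.
rewrite opprB addrC subrK ler_pdivlMl // mulrC.
have f0 y : 0 <= trans y 0 by apply: trans_ge0.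
apply: le_trans (taboo_term_le 0 t _ x f0).
by rewrite ler_wpM2l ?taboo_ge0 ?trans_top0.
Unshelve. all: by end_near. Qed.

(** Going down from the top of level k: a fixed proportion of the mass at y is
sent to y + 1 at the next step. *)
Lemma taboo_cvg0 k x : p (k./2.+2) < 1 -> (x < fib k.+1)%N ->
  (taboo 0 t x @[t --> \oo] --> 0).
Proof.
move=> pk xk; suff H d : (d < fib k.+1)%N ->
    taboo 0 t ((fib k.+1).-1 - d)%N @[t --> \oo] --> 0.
  have -> : x = ((fib k.+1).-1 - ((fib k.+1).-1 - x))%N by lia.
  by apply: H; have := fib_gt0 k.+1; lia.
elim: d => [|d IH] dk; first by rewrite subn0; apply: taboo_top_cvg0.
set y := ((fib k.+1).-1 - d.+1)%N.
have yE : ((fib k.+1).-1 - d)%N = y.+1 by rewrite /y; lia.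
have {}IH := IH (ltnW dk); rewrite yE in IH.
have T0 := trans_up_gt0 y.
have IH' : (trans y y.+1)^-1 * taboo 0 t.+1 y.+1 @[t --> \oo] --> 0.
  rewrite -[X in _ --> X](mulr0 (trans y y.+1)^-1); apply: cvgM; first exact: cvg_cst.
  by rewrite (cvg_shiftS (fun t => taboo 0 t y.+1)).
apply: squeeze_cvgr (cvg_cst 0) IH'; near=> t; rewrite taboo_ge0.
by rewrite ler_pdivlMl // mulrC taboo_up.
Unshelve. all: by end_near. Qed.

(** The potential integrates to a constant c against the taboo law from time 1
on, so the mass above F_(k+1) is at most c divided by the potential there. The
mass below F_(k+1) tends to 0 if moreover p (k/2 + 2) < 1, and such k are
arbitrarily large since the potential is unbounded. *)
Lemma survival_cvg0 : (forall A, exists n, A <= level_potential n) ->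
  forall eps, 0 < eps -> exists t, survival 0 t <= eps.
Proof.
move=> unb eps eps0; pose f := potential 0.
have f0 : f 0%N = 0 by [].
pose c := taboo_sum 0 1 f.
have pc t : taboo_sum 0 t.+1 f = c.
  elim: t => [//|t IH]; rewrite taboo_sumS // -IH; apply: eq_bigr => x _.
  case: (posnP x) => [->|x0]; first by rewrite /= !mul0r.
  by rewrite /f potential_harmonic.
have c0 : 0 <= c by apply: sumr_ge0 => x _; rewrite mulr_ge0 ?taboo_ge0 ?potential_ge0.
(* Beyond level n the mass is at most eps / 2. *)
have [n nA] := unb (2 * c / eps + 1).
(* Otherwise the potential would be constant from level n on. *)
have [k nk pk] : exists2 k, (n <= k)%N & p (k./2.+2) < 1.
  have [l lA] := unb (level_potential n + 1).
  have [//|none] := pselect (exists2 k, (n <= k)%N & p (k./2.+2) < 1).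
  have const d : level_potential (n + d) = level_potential n.
    elim: d => [|d IH]; first by rewrite addn0.
    rewrite addnS level_potentialS IH.
    have -> : p ((n + d)./2.+2) = 1; last by rewrite invr1 mulr1.
    apply/eqP; rewrite eq_le; case/andP: (p01 ((n + d)./2.+2) isT) => _ -> /=.
    by rewrite leNgt; apply/negP => h; apply: none; exists (n + d)%N; rewrite ?leq_addr.
  have := level_potential_homo l (n + l)%N (leq_addl _ _).
  by rewrite const => h; have := le_trans lA h; rewrite gerDl ler10.
have low : \sum_(x < fib k.+1) taboo 0 t x @[t --> \oo] --> 0.
  rewrite [X in _ --> X](_ : 0 = \sum_(x < fib k.+1) (0 : R)); last by rewrite big1.
  by apply: cvg_big => [|x _]; [exact: add_continuous | apply: taboo_cvg0 pk _].
have e2 : 0 < eps / 2 by rewrite divr_gt0.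
have [t0 _ Ht] := cvgr0_norm_le _ low _ e2.
(* Taking t1 beyond F_(k+1) lets the sum over the states below F_(k+1) be read
   as a part of the sum over all reachable states. *)
pose t1 := maxn t0 (fib k.+1).
have /= lowt := Ht t1.+1 (leq_trans (leq_maxl _ _) (leqnSn _)).
exists t1.+1.
pose C := level_potential k.+1.
have C0 : 0 < C by apply: level_potential_gt0.
(* The Markov inequality, term by term. *)
have pt x : taboo 0 t1.+1 x <= (x < fib k.+1)%:R * taboo 0 t1.+1 x + taboo 0 t1.+1 x * f x / C.
  case: (ltnP x (fib k.+1)) => xk.
    rewrite mul1r lerDl divr_ge0 ?(ltW C0) // mulr_ge0 ?taboo_ge0 ?potential_ge0 //.
  rewrite mul0r add0r ler_pdivlMr // ler_wpM2l ?taboo_ge0 //.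
  have [l kl xl] := fib_level_ge _ _ xk.
  by rewrite /f (potential_level _ _ l) //; apply: level_potential_homo.
rewrite /survival /taboo_sum; under eq_bigr do rewrite mulr1.
apply: (@le_trans _ _ (\sum_(x < (0 + t1.+1).+1)
  ((x < fib k.+1)%:R * taboo 0 t1.+1 x + taboo 0 t1.+1 x * f x / C))).
  by apply: ler_sum => x _; apply: pt.
rewrite big_split /=.
rewrite -mulr_suml -/(taboo_sum 0 t1.+1 f) pc.
have -> : eps = eps / 2 + eps / 2 by field.
apply: lerD; last first.
  rewrite ler_pdivrMr //.
  have := level_potential_homo _ _ (leq_trans nk (leqnSn k)).
  move/(le_trans nA); rewrite -/C => h.
  have : 2 * c / eps <= C by apply: le_trans h; rewrite lerDl.
  rewrite ler_pdivrMr // => h2; lra.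
apply: le_trans lowt; apply: le_trans (ler_norm _).
under eq_bigr do rewrite mulr_natl mulrb.
rewrite -big_mkcond /=.
rewrite -(big_ord_widen _ (taboo 0 t1.+1)) // add0n.
by rewrite (leq_trans (leq_maxr t0 _)) // ltnW.
Qed.

End Potential.

(** * The product of the parameters *)
Section Product.
Context {R : realType}.
Variable p : nat -> R.
Hypothesis p01 : forall i, (1 <= i)%N -> 0 < p i <= 1.

(** Levels 2i and 2i + 1 share the parameter p_(i+2), whence the square; p_1 does
not occur. *)
Lemma level_potential_double n :
  level_potential p n.*2 = (p 1 / run_prob p n.+1) ^+ 2.
Proof.
have p0 i : p i.+1 != 0 by apply: lt0r_neq0; case/andP: (p01 i.+1 isT).
elim: n => [|n IH].
  by rewrite /level_potential /run_prob big_ord0 big_ord1 divff // expr1n.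
rewrite doubleS !level_potentialS IH /= uphalf_double doubleK (run_probS _ n.+1).
have r0 : run_prob p n.+1 != 0 by apply: lt0r_neq0; apply: run_prob_gt0.
by field; rewrite p0 r0.
Qed.

Lemma run_prob_homo s t : (s <= t)%N -> run_prob p t <= run_prob p s.
Proof.
move=> st; rewrite -(subnKC st); elim: (t - s)%N => [|u IH]; first by rewrite addn0.
by rewrite addnS (le_trans (run_prob_decr _ p01 _)).
Qed.

Lemma run_prob_cvg : cvgn (run_prob p).
Proof.
apply: nonincreasing_is_cvgn; first by move=> s t; apply: run_prob_homo.
by exists 0 => _ [t _ <-]; apply/ltW/run_prob_gt0.
Qed.

Lemma run_prob_ge_lim n : limn (run_prob p) <= run_prob p n.
Proof.
by apply: nonincreasing_cvgn_ge run_prob_cvg _ => s t; apply: run_prob_homo.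
Qed.

Lemma potential_bounded : 0 < limn (run_prob p) ->
  exists G, forall n x, potential p n x <= G.
Proof.
set l := limn _ => l0; exists ((p 1 / l) ^+ 2) => n x.
case: (ltnP x (fib n)) => [/potential_lt->|/fib_level_ge[k nk xk]].
  by rewrite exprn_ge0 // divr_ge0 ?(ltW l0) //; case/andP: (p01 1 isT) => /ltW.
rewrite (potential_level _ _ _ _ nk xk).
apply: (le_trans (level_potential_homo _ p01 k k.*2 _)); first by rewrite -addnn leq_addr.
rewrite level_potential_double; case/andP: (p01 1 isT) => p1 _.
have r0 := run_prob_gt0 _ p01 k.+1.
rewrite ler_pXn2r ?nnegrE ?divr_ge0 ?(ltW p1) ?(ltW l0) ?(ltW r0) //.
by rewrite ler_pM2l // lef_pV2 ?posrE ?run_prob_gt0 // run_prob_ge_lim.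
Qed.

Lemma potential_unbounded : ~ 0 < limn (run_prob p) ->
  forall A, exists n, A <= level_potential p n.
Proof.
move=> l0 A; have lE : limn (run_prob p) = 0.
  apply/eqP; rewrite eq_le; move/negP: l0; rewrite -leNgt => -> /=.
  by apply: limr_ge; [exact: run_prob_cvg | near=> n; apply/ltW/run_prob_gt0].
have cv : run_prob p @ \oo --> 0 by rewrite -lE; apply: run_prob_cvg.
case/andP: (p01 1 isT) => p1 _.
pose B := Num.max A 1.
have B1 : 1 <= B by rewrite le_max lexx orbT.
have B0 : 0 < B by apply: lt_le_trans B1.
have [n0 _ Hn] := cvgr0_norm_le _ cv _ (divr_gt0 p1 B0).
have /= rB := Hn n0.+1 (leqnSn _).
exists n0.*2; rewrite level_potential_double.
have BL : B <= p 1 / run_prob p n0.+1.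
  rewrite ler_pdivlMr ?run_prob_gt0 // mulrC -ler_pdivlMr //.
  exact: le_trans (ler_norm _) rB.
apply: (@le_trans _ _ B); first by rewrite le_max lexx.
by rewrite (le_trans BL) // ler_eXnr // (le_trans B1).
Unshelve. all: by end_near. Qed.

End Product.

(** * Events depending on finitely many draws *)
Section Draws.
Context {d} {T : measurableType d} {R : realType} {P : probability T R}.
Variables (p : nat -> R) (e : nat * nat -> {RV P >-> bool}).
Hypothesis he : fib_draws p e.

Local Notation config := (nat * nat -> bool).
Implicit Types (phi psi : config -> bool) (w : config) (j : nat * nat).

Definition depends_on (J : seq (nat * nat)) phi :=
  forall w w', {in J, w =1 w'} -> phi w = phi w'.

Definition finitary phi := exists J, depends_on J phi.

(** Events are given by boolean functions of a configuration of draws, so that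
conjunctions, restrictions and dependence on coordinates are stated outside the
probability space. *)
Definition event phi : set T := [set u | phi (fun j => e j u)].

Lemma event_andb phi psi :
  event (fun w => phi w && psi w) = event phi `&` event psi.
Proof. by apply/seteqP; split => u /=; [move/andP | move=> h; apply/andP]. Qed.

Lemma event_neg phi : event (fun w => ~~ phi w) = ~` event phi.
Proof. by apply/seteqP; split => u /=; [move/negP | move=> h; apply/negP]. Qed.

Lemma eq_event phi psi : phi =1 psi -> event phi = event psi.
Proof. by move=> h; apply/seteqP; split => u; rewrite /event /= h. Qed.

Lemma finitary_andb phi psi :
  finitary phi -> finitary psi -> finitary (fun w => phi w && psi w).
Proof.
move=> [J hJ] [K hK]; exists (J ++ K) => w w' h.
by rewrite (hJ w w') ?(hK w w') // => j jJ; apply: h; rewrite mem_cat jJ ?orbT.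
Qed.

Lemma finitary_neg phi : finitary phi -> finitary (fun w => ~~ phi w).
Proof. by move=> [J hJ]; exists J => w w' /hJ ->. Qed.

Lemma finitary_coord j b : finitary (fun w => w j == b).
Proof. by exists [:: j] => w w' h; rewrite h ?mem_head. Qed.

Lemma finitary_bit j : finitary (fun w => w j).
Proof. by exists [:: j] => w w' h; rewrite h ?mem_head. Qed.

Lemma finitary_all (I : eqType) (s : seq I) (F : I -> config -> bool) :
  (forall i, finitary (F i)) -> finitary (fun w => all (fun i => F i w) s).
Proof.
move=> FF; elim: s => [|i s IH] /=; first by exists [::].
exact: finitary_andb.
Qed.

Definition update w j b : config := fun i => if i == j then b else w i.

Lemma depends_update j J phi b : depends_on (j :: J) phi ->
  depends_on J (fun w => phi (update w j b)).
Proof.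
move=> h w w' ww; apply: h => i; rewrite inE /update.
by case: eqP => //= _ /ww.
Qed.

Lemma update_id w j : update w j (w j) = w.
Proof. by apply/funext => i; rewrite /update; case: eqP => [->|]. Qed.

(** Conditioning on one draw removes it from the dependencies. *)
Lemma event_split phi j : event phi =
  event (fun w => (w j == true) && phi (update w j true)) `|`
  event (fun w => (w j == false) && phi (update w j false)).
Proof.
apply/seteqP; split => u; rewrite /event /=.
  move=> h; have := update_id (fun i => e i u) j; case: (e j u) => E; [left|right];
  by rewrite E.
by case=> /andP[/eqP E]; rewrite -{1}E update_id.
Qed.

Lemma measurable_coord j b : measurable (event (fun w => w j == b)).
Proof.
have -> : event (fun w => w j == b) = e j @^-1` [set b].
  by apply/seteqP; split => u /= /eqP.
exact: measurable_funPTI.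
Qed.

Lemma measurable_event phi : finitary phi -> measurable (event phi).
Proof.
move=> [J]; elim: J phi => [|j J IH] phi hJ.
  have [c cE] : exists c, forall w, phi w = c.
    by exists (phi (fun=> true)) => w; apply: hJ.
  rewrite (eq_event _ _ cE); case: c {cE}.
    by rewrite (_ : event _ = setT) //; apply/seteqP; split.
  by rewrite (_ : event _ = set0) //; apply/seteqP; split.
rewrite (event_split phi j) !event_andb; apply: measurableU; apply: measurableI;
  by [apply: measurable_coord | apply/IH/depends_update].
Qed.

Definition prob phi := fine (P (event phi)).

Lemma probE phi : finitary phi -> P (event phi) = (prob phi)%:E.
Proof. by move=> f; rewrite fineK // fin_num_measure //; apply: measurable_event. Qed.

Lemma eq_prob phi psi : phi =1 psi -> prob phi = prob psi.
Proof. by move=> h; rewrite /prob (eq_event _ _ h). Qed.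

Lemma prob_split phi psi : finitary phi -> finitary psi ->
  prob phi = prob (fun w => phi w && psi w) + prob (fun w => phi w && ~~ psi w).
Proof.
move=> f g; have ng := finitary_neg _ g.
apply: EFin_inj; rewrite EFinD -!probE //; try exact: finitary_andb.
rewrite -measureU; first last.
- rewrite -event_andb -(_ : event (fun=> false) = set0).
    by apply: eq_event => w; case: (psi w); rewrite ?andbF.
  by apply/seteqP; split.
- exact/measurable_event/finitary_andb.
- exact/measurable_event/finitary_andb.
rewrite !event_andb -setIUr event_neg setUv setIT //.
Qed.

Lemma prob_sum n (Z : config -> nat) phi : finitary phi ->
  (forall i, finitary (fun w => Z w == i)) -> (forall w, phi w -> (Z w < n)%N) ->
  prob phi = \sum_(i < n) prob (fun w => phi w && (Z w == i)).
Proof.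
elim: n phi => [|n IH] phi f g h.
  rewrite big_ord0 /prob (_ : event phi = set0) ?measure0 //.
  by apply/seteqP; split => u //= /h.
rewrite big_ord_recr /= (prob_split phi (fun w => Z w == n)) // addrC; congr (_ + _).
rewrite (IH _ (finitary_andb _ _ f (finitary_neg _ (g n)))) //.
  apply: eq_bigr => i _; apply: eq_prob => w; case: (Z w =P i) => [->|]; last by rewrite !andbF.
  by rewrite ltn_eqF // !andbT.
by move=> w /andP[/h]; rewrite ltnS leq_eqVlt => /orP[->|].
Qed.

(** The cylinder given by a list of prescribed draws; the list may prescribe a
draw twice, possibly inconsistently, in which case [allowed] is empty at that
index. *)
Definition obeys (c : seq ((nat * nat) * bool)) w := all (fun jb => w jb.1 == jb.2) c.

Lemma finitary_obeys c : finitary (obeys c).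
Proof. by apply: finitary_all => i; apply: finitary_coord. Qed.

Definition allowed (c : seq ((nat * nat) * bool)) j : set bool :=
  [set b | all (fun jb => (jb.1 == j) ==> (b == jb.2)) c].

Lemma event_obeys c : event (obeys c) =
  \bigcap_(i in [set` [fset j in map fst c]%fset]) (e i @^-1` allowed c i).
Proof.
apply/seteqP; split => u /=.
  move=> /allP h i _; apply/allP => jb /h /eqP <-.
  by case: eqP => // ->; rewrite eqxx.
move=> h; apply/allP => -[j b] jb /=.
have /= := h j; rewrite in_fset /= => /(_ (map_f fst jb)) /allP /(_ _ jb) /=.
by rewrite eqxx.
Qed.

Lemma obeys_indep c j : j \notin map fst c ->
  (P (event (fun w => obeys c w && w j)) = P (event (obeys c)) * P (event (fun w => w j)))%E.
Proof.
move=> jc; case: (he) => indep _.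
pose J := [fset j in map fst c]%fset.
have inJ i : (i \in J) = (i \in map fst c) by rewrite /J in_fset.
have jJ : j \notin J by rewrite inJ.
pose A i := if i == j then [set true] else allowed c i.
have AJ i : i \in J -> A i = allowed c i.
  by move=> iJ; rewrite /A; case: eqP iJ jJ => // -> ->.
have bitE : event (fun w => w j) = e j @^-1` [set true] by apply/seteqP; split.
have mA i : measurable (A i) by [].
have := indep (j |` J)%fset A (fun i _ => mA i).
rewrite big_fsetU1 //= {2}/A eqxx -bitE.
rewrite (eq_big_seq (fun i => P (e i @^-1` allowed c i))); last by move=> i /AJ ->.
rewrite -(indep J (allowed c) (fun _ _ => _)) // -event_obeys muleC => <-.
congr (P _); rewrite event_andb event_obeys bitE.
apply/seteqP; split => u /=.
  move=> [h1 h2] i /=; rewrite in_fset1U => /orP[/eqP ->|iJ]; first by rewrite /A eqxx.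
  by rewrite AJ //; apply: h1.
move=> h; split=> [i iJ|].
  by rewrite /= -AJ //; apply: h; rewrite /= in_fset1U iJ orbT.
by have := h j; rewrite /= /A eqxx; apply; rewrite in_fset1U eqxx.
Qed.

(** Induction on the dependencies of phi: conditioning on the first of them moves
it from phi to the cylinder c, until only the cylinder remains, where mutual
independence applies. *)
Lemma bit_indep_obeys J phi j c : depends_on J phi -> j \notin J ->
  j \notin map fst c ->
  prob (fun w => (obeys c w && phi w) && w j) =
  prob (fun w => obeys c w && phi w) * prob (fun w => w j).
Proof.
elim: J phi c => [|i J IH] phi c hJ jJ jc.
  have [b bE] : exists b, forall w, phi w = b.
    by exists (phi (fun=> true)) => w; apply: hJ.
  case: b bE => bE; last first.
    have z psi : (forall w, psi w = false) -> prob psi = 0.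
      move=> h; rewrite /prob (_ : event psi = set0) ?measure0 //.
      by apply/seteqP; split => u //=; rewrite /event /= h.
    by rewrite [LHS]z ?[X in X * _]z ?mul0r // => w; rewrite bE !andbF.
  rewrite (eq_prob (fun w => obeys c w && phi w) (obeys c)); last first.
    by move=> w; rewrite bE andbT.
  rewrite (eq_prob _ (fun w => obeys c w && w j)); last by move=> w; rewrite bE andbT.
  have fj := finitary_bit j; have fc := finitary_obeys c.
  apply: EFin_inj; rewrite EFinM -!probE //; last exact: finitary_andb.
  exact: obeys_indep.
move: jJ; rewrite inE negb_or => /andP[ji jJ].
have fphi : finitary phi by exists (i :: J).
have fc := finitary_obeys c.
have fcp := finitary_andb _ _ fc fphi.
have fi := finitary_coord i true.
have half b : prob (fun w => ((obeys c w && phi w) && w j) && (w i == b)) =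
    prob (fun w => (obeys c w && phi w) && (w i == b)) * prob (fun w => w j).
  have E w : (obeys c w && phi w) && (w i == b) =
      obeys ((i, b) :: c) w && phi (update w i b).
    rewrite /= andbC -andbA; case: eqP => //= <-.
    by rewrite update_id.
  rewrite (eq_prob _ _ E) -(IH _ _ (depends_update _ _ _ b hJ)) //.
    by apply: eq_prob => w; rewrite -E -!andbA [w j && _]andbC.
  by rewrite inE negb_or ji.
rewrite (prob_split _ (fun w => w i == true)) //; last exact: finitary_andb (finitary_bit j).
rewrite [X in X * _](prob_split _ (fun w => w i == true)) // mulrDl half; congr (_ + _).
have N w : ~~ (w i == true) = (w i == false) by case: (w i).
rewrite (eq_prob _ (fun w => ((obeys c w && phi w) && w j) && (w i == false))).
  rewrite half; congr (_ * _); apply: eq_prob => w; by rewrite N.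
by move=> w; rewrite N.
Qed.

Lemma bit_indep J phi j : depends_on J phi -> j \notin J ->
  prob (fun w => phi w && w j) = prob phi * prob (fun w => w j).
Proof. by move=> hJ jJ; apply: (bit_indep_obeys J phi j [::]). Qed.

Lemma prob_bit t i : prob (fun w => w (t, i)) = p i.+1.
Proof. by case: he => _ h; rewrite /prob /event /= h. Qed.

End Draws.

(** * The law of the chain *)
Section Walk.
Context {d} {T : measurableType d} {R : realType} {P : probability T R}.
Variables (p : nat -> R) (e : nat * nat -> {RV P >-> bool}).
Hypothesis he : fib_draws p e.

Local Notation config := (nat * nat -> bool).
Local Notation prob := (prob e).
Local Notation event := (event e).
Implicit Types (phi : config -> bool) (w : config) (N t x y m : nat).

(** The chain as a function of the configuration of draws alone. *)
Fixpoint walk N t w : nat :=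
  match t with
  | 0 => N
  | s.+1 => step (walk N s w) (fun i => w (s, i))
  end.

Definition avoids N t w := all (fun s => walk N s.+1 w != N) (iota 0 t).

Definition at_state N t x w := avoids N t w && (walk N t w == x).

Lemma walkE N t u : walk N t (fun j => e j u) = chain e N t u.
Proof. by elim: t => [//|t IH] /=; rewrite IH. Qed.

Lemma walk_le N t w : (walk N t w <= N + t)%N.
Proof.
elim: t => [|t IH] /=; first by rewrite addn0.
by rewrite stepE addnS (leq_trans (land_le _ _)).
Qed.

(** The draws that the walk uses before time t: at each of these times the state
is at most N + t, and a step from x uses no draw beyond x. *)
Definition past N t := [seq (s, i) | s <- iota 0 t, i <- iota 0 (N + t).+1].

Lemma eq_walk N t s w w' : (s <= t)%N -> {in past N t, w =1 w'} ->
  walk N s w = walk N s w'.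
Proof.
move=> + ww; elim: s => [//|s IH] st /=; rewrite -IH ?(ltnW st) //.
apply: eq_step => i ix; apply: ww; apply: allpairs_f; rewrite mem_iota ?add0n //=.
by have := walk_le N s w; lia.
Qed.

Lemma walk_depends N t x : depends_on (past N t) (fun w => walk N t w == x).
Proof. by move=> w w' /(eq_walk N t t) ->. Qed.

Lemma at_state_depends N t x : depends_on (past N t) (at_state N t x).
Proof.
move=> w w' ww; rewrite /at_state (walk_depends _ _ _ _ _ ww); congr (_ && _).
apply: eq_in_all => s; rewrite mem_iota => /andP[_ st].
by rewrite (eq_walk N t s.+1 w w').
Qed.

Lemma finitary_walk N t x : finitary (fun w => walk N t w == x).
Proof. by exists (past N t); apply: walk_depends. Qed.

Lemma finitary_avoids N t : finitary (avoids N t).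
Proof.
apply: finitary_all => s; apply: (finitary_neg (fun w => walk N s.+1 w == N)).
exact: finitary_walk.
Qed.

Lemma finitary_at_state N t x : finitary (at_state N t x).
Proof. by exists (past N t); apply: at_state_depends. Qed.

Local Notation ones t m w := (all (fun i => w (t, i)) (iota 0 m)).

Lemma finitary_ones t m : finitary (fun w => ones t m w).
Proof. by apply: finitary_all => i; apply: finitary_bit. Qed.

(** The Markov property, on the events which generate the law of [stop]. *)
Lemma ones_indep N t x m :
  prob (fun w => at_state N t x w && ones t m w) =
  prob (at_state N t x) * run_prob p m.
Proof.
elim: m => [|m IH].
  by rewrite /run_prob big_ord0 mulr1; apply: eq_prob => w; rewrite andbT.
rewrite run_probS mulrA -IH -(prob_bit _ _ he t m).
rewrite -(bit_indep _ _ he (past N t ++ [seq (t, i) | i <- iota 0 m])).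
- apply: eq_prob => w; rewrite -andbA; congr (_ && _).
  by rewrite -addn1 iotaD all_cat /= andbT.
- move=> w w' ww; congr (_ && _).
    by apply: at_state_depends => j jp; apply: ww; rewrite mem_cat jp.
  apply: eq_in_all => i im; apply: ww; rewrite mem_cat map_f ?orbT //.
rewrite mem_cat negb_or; apply/andP; split; apply/negP.
  by case/allpairsP => -[s i] /= [+ _ [ts _]]; rewrite mem_iota; lia.
by case/mapP => i + [mi]; rewrite mem_iota; lia.
Qed.

Local Notation halt x t w := (stop x (fun i => w (t, i))).

Lemma finitary_halt t x m : finitary (fun w => halt x t w == m).
Proof.
exists [seq (t, i) | i <- iota 0 x.+1] => w w' ww; congr (_ == _).
apply: eq_in_find => i ir; rewrite ww // map_f //; move: ir; rewrite !mem_iota.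
by have := run_le x; lia.
Qed.

(** The event that stop takes the value m is the difference of the events that
the first m, resp. the first m + 1, draws all succeed. *)
Lemma halt_prob N t x m : (m <= (run x).+1)%N ->
  prob (fun w => at_state N t x w && (halt x t w == m)) =
  prob (at_state N t x) * weight p x m.
Proof.
rewrite leq_eqVlt => /orP[/eqP ->|mr].
  rewrite /weight ltnn -ones_indep; apply: eq_prob => w.
  by rewrite -(leq_stop x) // eqn_leq stop_le.
rewrite /weight -ltnS mr mulrBr -!ones_indep.
have fa := finitary_at_state N t x.
rewrite [X in X - _](prob_split e _ (fun w => ones t m.+1 w)); last 2 first.
- exact: finitary_andb (finitary_ones _ _).
- exact: finitary_ones.
rewrite (eq_prob e (fun w => _ && _ && ones t m.+1 w)
  (fun w => at_state N t x w && ones t m.+1 w)); last first.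
  move=> w; rewrite -andbA; congr (_ && _).
  by rewrite -!(leq_stop x) ?(ltnW mr) //; apply: andb_idl => /ltnW.
rewrite addrAC subrr add0r; apply: eq_prob => w; rewrite -andbA; congr (_ && _).
by rewrite -!(leq_stop x) ?(ltnW mr) // -ltnNge eqn_leq ltnS andbC.
Qed.

Lemma step_prob N t x y :
  prob (fun w => at_state N t x w && (walk N t.+1 w == y)) =
  prob (at_state N t x) * trans p x y.
Proof.
have fs : finitary (fun w => at_state N t x w && (walk N t.+1 w == y)).
  by apply: finitary_andb; [exact: finitary_at_state | exact: finitary_walk].
rewrite (prob_sum e (run x).+2 (fun w => halt x t w)) //; first last.
- by move=> w _; rewrite ltnS stop_le.
- by move=> m; apply: finitary_halt.
rewrite /trans mulr_sumr; apply: eq_bigr => m _.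
rewrite mulrA -halt_prob ?leq_ord //.
have E w : (at_state N t x w && (walk N t.+1 w == y)) && (halt x t w == m) =
    (at_state N t x w && (halt x t w == m)) && (land x m == y).
  case: (boolP (at_state N t x w)) => //= /andP[_ /eqP wx].
  by rewrite wx stepE andbC; case: eqP => // ->.
rewrite (eq_prob _ _ _ E); case: eqP => _.
  by rewrite mulr1; apply: eq_prob => w; rewrite andbT.
rewrite mulr0 /prob (_ : event _ = set0) ?measure0 //.
by apply/seteqP; split => u //=; rewrite /event /= andbF.
Qed.

Lemma at_state_prob N t y : prob (at_state N t y) = taboo p N t y.
Proof.
elim: t y => [|t IH] y.
  rewrite /= /prob /event /at_state /= eq_sym; case: eqP => _.
    by rewrite (_ : [set u | _] = setT) ?probability_setT //; apply/seteqP; split.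
  by rewrite (_ : [set u | _] = set0) ?measure0 //; apply/seteqP; split.
have avS w : avoids N t.+1 w = avoids N t w && (walk N t.+1 w != N).
  by rewrite /avoids -addn1 iotaD all_cat /= andbT addn1.
rewrite [RHS]/=; case: (eqVneq y N) => [->|yN].
  rewrite /prob (_ : event _ = set0) ?measure0 //.
  apply/seteqP; split => u //=; rewrite /event /= /at_state avS.
  by case: eqP; rewrite ?andbF.
have E w : at_state N t.+1 y w = avoids N t w && (walk N t.+1 w == y).
  rewrite /at_state avS -andbA; congr (_ && _).
  by case: (_ =P y) => [->|_]; rewrite ?yN ?andbF.
rewrite (prob_sum e (N + t).+1 (walk N t)); first last.
- by move=> w _; rewrite ltnS walk_le.
- by move=> x; apply: finitary_walk.
- exact: finitary_at_state.
apply: eq_bigr => x _; rewrite -IH -step_prob; apply: eq_prob => w.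
by rewrite E /at_state -!andbA; congr (_ && _); rewrite andbC.
Qed.

Lemma avoids_prob N t : prob (avoids N t) = survival p N t.
Proof.
rewrite (prob_sum e (N + t).+1 (walk N t)); first last.
- by move=> w _; rewrite ltnS walk_le.
- by move=> x; apply: finitary_walk.
- exact: finitary_avoids.
by apply: eq_bigr => x _; rewrite mulr1 -at_state_prob.
Qed.

Definition return_by N t : set T := ~` event (avoids N t).

Lemma return_byE N :
  [set u | exists t, chain e N t.+1 u = N] = \bigcup_t return_by N t.
Proof.
apply/seteqP; split => u /=.
  move=> [t]; rewrite -[step _ _]/(chain e N t.+1 u) -walkE => ut; exists t.+1 => //.
  rewrite /return_by /event /= => /allP /(_ t); rewrite mem_iota add0n leqnn ut eqxx.
  by move/(_ isT).
move=> [t _]; rewrite /return_by /event /= => /negP /allPn[s _ /negPn /eqP us].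
by exists s; rewrite -walkE.
Qed.

Lemma measurable_return_by N t : measurable (return_by N t).
Proof. exact/measurableC/measurable_event/finitary_avoids. Qed.

Lemma return_by_prob N t : P (return_by N t) = (1 - survival p N t)%:E.
Proof.
rewrite probability_setC; last exact/measurable_event/finitary_avoids.
by rewrite probE ?avoids_prob //; apply: finitary_avoids.
Qed.

(** The probability of a return is the increasing limit of the probabilities of a
return by time t, which are the complements to 1 of the survival
probabilities. *)
Lemma transient_stateP N : transient_state e N <->
  exists2 c, 0 < c & forall t, c <= survival p N t.
Proof.
rewrite /transient_state return_byE.
have mU : measurable (\bigcup_t return_by N t).
  by apply: bigcup_measurable => t _; apply: measurable_return_by.
split.
  move=> lt1; exists (1 - fine (P (\bigcup_t return_by N t))).
    by rewrite subr_gt0 -lte_fin fineK ?fin_num_measure.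
  move=> t; rewrite lerBlDr -lerBlDl -lee_fin fineK ?fin_num_measure //.
  rewrite -return_by_prob; apply: le_measure; rewrite ?inE //.
    exact: measurable_return_by.
  exact: bigcup_sup.
move=> [c c0 cs]; apply: (@le_lt_trans _ _ (1 - c)%:E); last first.
  by rewrite lte_fin gtrBl.
have nd : nondecreasing_seq (return_by N).
  move=> s t st; apply/subsetPset => u; rewrite /return_by /event /=.
  apply: contra_not; rewrite /avoids -(subnKC st) iotaD all_cat.
  by case/andP.
have cv := nondecreasing_cvg_mu (mu := P) (measurable_return_by N) mU nd.
rewrite -(cvg_lim _ cv) //; apply: lime_le; first by apply/cvg_ex; eexists; exact: cv.
by near=> t; rewrite /= return_by_prob lee_fin lerB.
Unshelve. all: by end_near. Qed.

End Walk.

Theorem proposition2p1 (R : realType) (p : nat -> R)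
  (p01 : forall i : nat, (1 <= i)%N -> 0 < p i <= 1)
  (d : measure_display) (T : measurableType d) (P : probability T R)
  (e : nat * nat -> {RV P >-> bool}) (he : fib_draws p e) :
  transient_chain e <-> 0 < limn (fun n : nat => \prod_(1 <= i < n.+1) p i).
Proof.
have -> : (fun n : nat => \prod_(1 <= i < n.+1) p i) = run_prob p.
  by apply/funext => n; rewrite big_add1 big_mkord.
split=> [trans0|l0].
  apply: contrapT => nl0.
  have [c c0 cs] := iffLR (transient_stateP p e he 0) (trans0 0%N).
  have := survival_cvg0 p p01 (potential_unbounded p p01 nl0) (c / 2).
  rewrite divr_gt0 // => /(_ isT)[t tc].
  by have := le_trans (cs t) tc; rewrite ler_pdivlMr // ger_pMr // leNgt ltr1n.
move=> N; apply/(transient_stateP p e he).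
have [G GP] := potential_bounded p p01 l0.
exact: survival_lower (GP N).
Qed.
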